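(* The polytope $P=P_n(123,132)$ is a combinatorial cube with Ehrhart polynomial \[ |mP\cap\mathbb{Z}^n| =\frac{m + 1}{(n-1)!}\prod_{j=2}^{n-1}{(nm + j)}. \]
   Context: $P_n(123,132)=\operatorname{conv}\{(a_1,\dots,a_n)\in\mathbb{R}^n : a_1\cdots a_n\in\mathfrak{S}_n$ avoids both patterns $123$ and $132\}$. A combinatorial cube is a polytope whose face lattice is isomorphic to that of a cube.
   Formalization: The Ehrhart formula is stated for n ≥ 2 only: for n = 1 the polytope is the single point 1, so |mP ∩ Z| = 1, while the displayed formula gives m + 1; the combinatorial-cube claim is for all n ≥ 1. *)

(* Defs.v *)
From mathcomp Require Export all_boot all_order all_algebra all_fingroup.
From mathcomp Require Export boolp classical_sets functions cardinality.
From mathcomp Require Export reals convex.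

Set Implicit Arguments.
Unset Strict Implicit.
Unset Printing Implicit Defensive.

Import Order.TTheory GRing.Theory Num.Theory.

Local Open Scope classical_set_scope.
Local Open Scope ring_scope.

(* A pattern is given as a word, e.g. [:: 1; 3; 2]; it occurs in s when some
   subsequence of s(0) ... s(n-1) is order-isomorphic to it. *)
Definition contains_pattern (n : nat) (s : 'S_n) (p : seq nat) : Prop :=
  exists f : 'I_(size p) -> 'I_n,
    (forall i j : 'I_(size p), (i < j)%N -> (f i < f j)%N) /\
    (forall i j : 'I_(size p),
       (s (f i) < s (f j))%N = (nth 0%N p i < nth 0%N p j)%N).

Definition avoids (n : nat) (s : 'S_n) (p : seq nat) : Prop :=
  ~ contains_pattern s p.

(* 'S_n permutes {0, ..., n-1}; the coordinates a_i range over {1, ..., n}. *)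
Definition perm_point (R : realType) (n : nat) (s : 'S_n) : 'rV[R]_n :=
  \row_i (s i).+1%:R.

Definition conv_hull (R : realType) (n : nat) (A : set 'rV[R]_n) :
    set 'rV[R]_n :=
  smallest (@convex_set R 'rV[R]_n) A.

Definition avoidance_polytope (R : realType) (n : nat) (Pi : seq (seq nat)) :
    set 'rV[R]_n :=
  conv_hull
    (@perm_point R n @` [set s : 'S_n | {in Pi, forall p, avoids s p}]).
Arguments avoidance_polytope R n Pi : clear implicits.

Definition is_polytope (R : realType) (n : nat) (P : set 'rV[R]_n) : Prop :=
  exists V : set 'rV[R]_n, finite_set V /\ P = conv_hull V.

Definition dot (R : realType) (n : nat) (c x : 'rV[R]_n) : R :=
  \sum_(i < n) c 0 i * x 0 i.

(* The choice c = 0 yields the two improper faces: set0 (b = 1) and P itself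
   (b = 0). *)
Definition is_face (R : realType) (n : nat) (P F : set 'rV[R]_n) : Prop :=
  exists (c : 'rV[R]_n) (b : R),
    (forall x, P x -> dot c x <= b) /\ F = P `&` [set x | dot c x = b].

(* Face lattices are ordered by inclusion, so a lattice isomorphism is the same
   thing as a bijection that preserves and reflects inclusion. *)
Definition face_lattice_iso (R : realType) (n d : nat)
    (P : set 'rV[R]_n) (Q : set 'rV[R]_d) : Prop :=
  exists f : set 'rV[R]_n -> set 'rV[R]_d,
    set_bij [set F | is_face P F] [set G | is_face Q G] f /\
    (forall F G, is_face P F -> is_face P G -> (F `<=` G <-> f F `<=` f G)).

Definition unit_cube (R : realType) (d : nat) : set 'rV[R]_d :=
  [set x | forall i, 0 <= x 0 i <= 1].
Arguments unit_cube R d : clear implicits.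

Definition combinatorial_cube (R : realType) (n : nat) (P : set 'rV[R]_n) :
    Prop :=
  is_polytope P /\ exists d : nat, face_lattice_iso P (unit_cube R d).

Definition dilate (R : realType) (n m : nat) (P : set 'rV[R]_n) :
    set 'rV[R]_n :=
  [set m%:R *: x | x in P].

Definition lattice_points (R : realType) (n : nat) : set 'rV[R]_n :=
  [set x | forall i, x 0 i \is a Num.int].
Arguments lattice_points R n : clear implicits.

Definition is_ehrhart_polynomial (R : realType) (n : nat) (P : set 'rV[R]_n)
    (L : {poly rat}) : Prop :=
  forall m : nat, exists k : nat,
    (dilate m P `&` lattice_points R n #= `I_k)%card /\ k%:R = L.[m%:R].

(* Main.v *)
(** Put d = n - 1 and b_i = a_i - (d - i), positions being counted from 0.  A
permutation avoids 123 and 132 iff every entry has at most one larger entry to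
its right; in terms of b this says that b_i is either 0 or the slack
e_i = i + 1 - (b_0 + ... + b_(i-1)), with b_d = e_d.  Hence P is the
Pitman-Stanley polytope b >= 0, b_0 + ... + b_i <= i + 1, with equality for
i = d: the substitution b_i = t_i e_i maps the cube [0,1]^d bijectively onto
this polytope, and, being affine in each t_i separately, it maps the cube into
the convex hull of the images of the vertices.

A linear functional pulls back along this chart to
K - sum_k e_k (max(s_k, 0) - s_k t_k) with e_k > 0 (maximise over the last
coordinates first), and every s in R^d arises.  So the faces of P are the images of
the faces of the cube.

Let f(k, e) be the number of natural sequences of length k whose partial sums are at
most e, e + m, e + 2m, ...  Then f(k+1, e) = f(k, m) + ... + f(k, m + e), whence
k! f(k, e) = (e + 1) prod_(2 <= j <= k) (e + k m + j); the lattice points of mP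
are counted by f(d, m). *)
Require Import Defs.
From mathcomp Require Import ring lra zify interval_inference.

Import Order.TTheory GRing.Theory Num.Theory.

(** * Counting sequences with bounded partial sums *)

(* Sequences of length [d] whose partial sums are at most e, e + m, e + 2m, ... *)
Fixpoint ps_seqs (m d e : nat) : seq (seq nat) :=
  if d is d'.+1 then
    [seq b :: s | b <- iota 0 e.+1, s <- ps_seqs m d' (e - b + m)]
  else [:: [::]].

Lemma mem_ps_seqs m d e (s : seq nat) :
  s \in ps_seqs m d e <->
  size s = d /\ forall i, i < d -> sumn (take i.+1 s) <= e + m * i.
Proof.
elim: d e s => [|d IH] e s.
  by rewrite /= inE; split=> [/eqP ->|[/size0nil -> _]].
split.
  case/allpairsPdep=> b [u] []; rewrite mem_iota add0n ltnS => be /IH [su hu] ->.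
  split=> [|[|i] hi] /=; rewrite ?su ?take0 //=; first by lia.
  have := hu i hi; nia.
case: s => [[]//|b u] [[su] hu].
have be : b <= e by have := hu 0 isT; rewrite /= take0 /=; lia.
apply/allpairsPdep; exists b, u; split=> //; first by rewrite mem_iota; lia.
by apply/IH; split=> // i hi; have := hu i.+1 hi; rewrite /=; nia.
Qed.

Lemma uniq_ps_seqs m d e : uniq (ps_seqs m d e).
Proof.
elim: d e => [//|d IH] e; apply: allpairs_uniq_dep => //.
- exact: iota_uniq.
- by move=> [b u] [b' u'] _ _ /= [-> ->].
Qed.

Lemma size_ps_seqsS m d e :
  size (ps_seqs m d.+1 e) = \sum_(x < e.+1) size (ps_seqs m d (x + m)).
Proof.
rewrite [LHS]size_allpairs_dep sumnE big_map.
rewrite -[iota 0 e.+1]/(index_iota 0 e.+1) big_mkord (reindex_inj rev_ord_inj) /=.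
by apply: eq_bigr => i _; congr (size (ps_seqs _ _ (_ + _))); have := ltn_ord i; lia.
Qed.

(** Induction on [d], then on [e]. Passing from e to e + 1 adds one summand to the recurrence; with
    the common product of d factors taken out, what remains is (e+1)(e+2+(d+2)m) + (d+2)(e+2+m) =
    (e+2)(e+d+3+(d+2)m). *)
Lemma size_ps_seqs m d e :
  size (ps_seqs m d.+1 e) * d.+1`! =
  e.+1 * \prod_(2 <= j < d.+2) (e + d.+1 * m + j).
Proof.
elim: d e => [|d IH] e.
  rewrite size_ps_seqsS big_geq // !muln1.
  by rewrite (eq_bigr (fun=> 1)) // sum1_card card_ord.
elim: e => [|e IHe].
  (* For e = 0 there is one summand, and the new factor j = d + 2 equals (d + 2)(m + 1). *)
  rewrite size_ps_seqsS big_ord_recl big_ord0 addn0 add0n factS mulnCA IH.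
  rewrite [in RHS]big_nat_recr //=.
  under eq_bigr do rewrite -mulSn.
  rewrite add0n; set X := \prod_(_ <= _ < _) _; lia.
rewrite size_ps_seqsS big_ord_recr -size_ps_seqsS /= mulnDl IHe factS.
rewrite [X in _ + X]mulnCA IH.
have -> : \prod_(2 <= j < d.+3) (e + d.+2 * m + j) =
    \prod_(1 <= j < d.+2) (e.+1 + d.+2 * m + j).
  by rewrite big_add1; apply: eq_bigr => j _; lia.
rewrite [in LHS]big_ltn // [in RHS]big_nat_recr //=.
under [X in _ + _ * (_ * X)]eq_bigr => j _.
  have -> : e.+1 + m + d.+1 * m + j = e.+1 + d.+2 * m + j by lia.
  over.
by set X := \prod_(_ <= _ < _) _; ring.
Qed.

(** * Permutations avoiding 123 and 132 *)

(** Remove the maximum [M] of [A]: as [A] lies in {0, ..., M}, [M] is at least #|A| - 1. *)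
Lemma sum_ord_le_set n (A : {set 'I_n}) :
  \sum_(i < #|A|) i <= \sum_(i in A) i.
Proof.
move: {2}#|A| (erefl #|A|) => k; elim: k A => [|k IH] A hA.
  by rewrite hA big_ord0.
have [a aA] : exists a, a \in A by apply/card_gt0P; rewrite hA.
pose M := [arg max_(i > a in A) (i : nat)].
have [MA Mmax] : M \in A /\ forall j, j \in A -> j <= M.
  by rewrite /M; case: arg_maxnP.
have kM : k <= M.
  have : #|A| <= #|[set i : 'I_n | i <= M]|.
    by apply/subset_leq_card/fintype.subsetP=> j jA; rewrite inE Mmax.
  have sub : M.+1 <= n by [].
  rewrite hA => h; rewrite -ltnS (leq_trans h) //.
  have -> : [set i : 'I_n | i <= M] = [set widen_ord sub j | j : 'I_M.+1].
    apply/setP=> i; rewrite inE; apply/idP/imsetP=> [iM|[j _ ->]].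
      have iM' : i < M.+1 by [].
      by exists (Ordinal iM') => //; apply/val_inj.
    by rewrite /= -ltnS.
  by rewrite (leq_trans (leq_imset_card _ _)) // card_ord.
have hA' : #|A :\ M| = k by move: hA; rewrite (cardsD1 M) MA => -[].
rewrite hA (bigD1 M) //= big_ord_recr /= addnC leq_add //.
rewrite (eq_bigl (mem (A :\ M))); last by move=> i; rewrite !inE andbC.
by have := IH _ hA'; rewrite hA'.
Qed.

(** The complements d - s(i), i < k, are k distinct naturals, so they sum to at least 0 + ... + (k -
    1). *)
Lemma sum_perm_prefix_le d (s : 'S_d.+1) k : k <= d.+1 ->
  \sum_(i < d.+1 | i < k) s i <= \sum_(i < d.+1 | i < k) (d - i).
Proof.
move=> kd.
have cardK : #|[set i : 'I_d.+1 | i < k]| = k.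
  rewrite -sum1dep_card -(big_ord_widen _ (fun=> 1) kd).
  by rewrite sum1_card card_ord.
pose A := [set rev_ord (s i) | i in [set i : 'I_d.+1 | i < k]].
have injrs : injective (fun i => rev_ord (s i)).
  by move=> i j /rev_ord_inj /perm_inj.
have cardA : #|A| = k by rewrite card_imset.
have := sum_ord_le_set _ A; rewrite cardA big_imset /=; last by move=> ? ? _ _ /injrs.
rewrite (big_ord_widen _ (fun i => i : nat) kd).
rewrite (eq_bigl (fun i : 'I_d.+1 => i < k)); last by move=> i; rewrite inE.
move=> h.
have e1 : \sum_(i < d.+1 | i < k) (d - s i) + \sum_(i < d.+1 | i < k) s i =
          \sum_(i < d.+1 | i < k) (d - i) + \sum_(i < d.+1 | i < k) i.
  rewrite -!big_split /=; apply: eq_bigr => i _.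
  by have := ltn_ord (s i); have := ltn_ord i; lia.
have e2 : \sum_(i < d.+1 | i < k) (d.+1 - (s i).+1) =
          \sum_(i < d.+1 | i < k) (d - s i) by apply: eq_bigr => i _; rewrite subSS.
by move: h; rewrite e2 -(leq_add2r (\sum_(i < d.+1 | i < k) s i)) e1 addnC leq_add2r.
Qed.

Lemma sum_perm_inord_le d (s : 'S_d.+1) k : k <= d.+1 ->
  \sum_(i < k) s (inord i) <= \sum_(i < k) (d - i).
Proof.
move=> kd; rewrite (big_ord_widen _ (fun i => s (inord i) : nat) kd).
rewrite (big_ord_widen _ (fun i => d - i) kd).
under eq_bigr do rewrite inord_val.
exact: sum_perm_prefix_le.
Qed.

Lemma sum_perm_inord d (s : 'S_d.+1) :
  \sum_(i < d.+1) s (inord i) = \sum_(i < d.+1) (d - i).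
Proof.
under eq_bigr do rewrite inord_val.
transitivity (\sum_(i < d.+1) i).
  by rewrite [RHS](reindex_inj (@perm_inj _ s)).
by rewrite (reindex_inj rev_ord_inj); apply: eq_bigr => i _; rewrite /= subSS.
Qed.

Definition avoiders {n} : set 'S_n :=
  [set s | {in [:: [:: 1; 2; 3]; [:: 1; 3; 2]], forall p, avoids s p}]%classic.

(** Two larger entries to the right of an entry form 123 or 132 with it, according to their
    order. *)
Lemma avoidersP n (s : 'S_n) : avoiders s <->
  forall i j k : 'I_n, i < j -> j < k -> ~ (s i < s j /\ s i < s k).
Proof.
split=> [hs i j k ij jk [sij sik]|hs p hp [f [fmono fs]]].
  have ik := ltn_trans ij jk.
  pose f (p : 'I_3) := nth i [:: i; j; k] p.
  have [sjk|skj] := ltnP (s j) (s k).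
    apply: (hs [:: 1; 2; 3]); first by rewrite !inE.
    exists f; split; first by case=> [[|[|[|//]]] ?] [[|[|[|//]]] ?].
    by case=> [[|[|[|//]]] ?] [[|[|[|//]]] ?]; rewrite /f /=; lia.
  have {}skj : s k < s j.
    rewrite ltn_neqAle skj andbT; apply/eqP=> /val_inj /perm_inj kj.
    by rewrite kj ltnn in jk.
  apply: (hs [:: 1; 3; 2]); first by rewrite !inE.
  exists f; split; first by case=> [[|[|[|//]]] ?] [[|[|[|//]]] ?].
  by case=> [[|[|[|//]]] ?] [[|[|[|//]]] ?]; rewrite /f /=; lia.
have [p3 p01 p02] : [/\ size p = 3, nth 0 p 0 < nth 0 p 1 & nth 0 p 0 < nth 0 p 2].
  by move: hp; rewrite !inE => /orP[] /eqP ->.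
have lt0 : 0 < size p by rewrite p3.
have lt1 : 1 < size p by rewrite p3.
have lt2 : 2 < size p by rewrite p3.
apply: (hs (f (Ordinal lt0)) (f (Ordinal lt1)) (f (Ordinal lt2))).
- exact: fmono.
- exact: fmono.
- by rewrite !fs.
Qed.

(** This is b_i >= 0. Of the d - s(i) values above s(i), at most i stand to the left of position [i]
    and, by avoidance, at most one to the right. *)
Lemma avoider_lower_bound d (s : 'S_d.+1) (i : 'I_d.+1) : avoiders s -> d - i <= (s i).+1.
Proof.
move=> /avoidersP hs.
pose L := [set j : 'I_d.+1 | s i < s j].
have cL : #|L| = d - s i.
  have -> : L = s @^-1: [set v : 'I_d.+1 | s i < v] by apply/setP=> j; rewrite !inE.
  rewrite card_preimset; last exact: perm_inj.
  have := cardsC [set v : 'I_d.+1 | v < (s i).+1]; rewrite card_ord.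
  have -> : #|[set v : 'I_d.+1 | v < (s i).+1]| = (s i).+1.
    rewrite -sum1dep_card -(big_ord_widen _ (fun=> 1) (ltn_ord (s i))).
    by rewrite sum1_card card_ord.
  rewrite (_ : ~: _ = [set v : 'I_d.+1 | s i < v]); last first.
    by apply/setP=> v; rewrite !inE -leqNgt.
  by have := ltn_ord (s i); lia.
have L1 : #|L :&: [set j : 'I_d.+1 | i < j]| <= 1.
  apply/card_le1P=> j; rewrite !inE => /andP[sij ij] k; rewrite !inE.
  apply/idP/eqP => [/andP[sik ik]|->]; last by rewrite sij ij.
  have [jk|kj|/val_inj->//] := ltngtP j k.
    by case: (hs i j k).
  by case: (hs i k j).
have L2 : #|L :\: [set j : 'I_d.+1 | i < j]| <= i.
  have ci : #|[set j : 'I_d.+1 | j < i]| = i.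
    rewrite -sum1dep_card -(big_ord_widen _ (fun=> 1) (ltnW (ltn_ord i))).
    by rewrite sum1_card card_ord.
  rewrite -[X in _ <= X]ci.
  apply/subset_leq_card/fintype.subsetP=> j; rewrite !inE -leqNgt => /andP[ji sij].
  rewrite ltn_neqAle ji andbT; apply: contraTneq sij => /val_inj ->.
  by rewrite ltnn.
have := cardsID [set j : 'I_d.+1 | i < j] L; rewrite cL.
by have := ltn_ord (s i); lia.
Qed.

(* The slack e_k of the vertex where b_i = e_i exactly when [c i]; it is one more
   than the number of consecutive [i] just before [k] with b_i = 0. *)
Fixpoint run (c : nat -> bool) (k : nat) : nat :=
  if k is k'.+1 then if c k' then 1 else (run c k').+1 else 1.

Lemma run_bounds c k : 1 <= run c k <= k.+1.
Proof. by elim: k => //= k; case: (c k) => //; lia. Qed.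

Lemma run_reset (c : nat -> bool) p j : c p -> p < j -> run c j <= j - p.
Proof.
move=> cp; elim: j => // j IH; rewrite ltnS leq_eqVlt => /orP[/eqP <-|/[dup] pj /IH] /=.
  by rewrite cp subSnn.
by case: (c j); lia.
Qed.

Lemma run_grow (c : nat -> bool) i j : i <= j -> (forall k, i <= k < j -> ~~ c k) ->
  run c j = run c i + (j - i).
Proof.
elim: j => [|j IH]; first by rewrite leqn0 => /eqP -> _; rewrite subnn addn0.
rewrite leq_eqVlt => /orP[/eqP <- _|ij h]; first by rewrite subnn addn0.
rewrite /= (negbTE (h j _)) ?IH //; try lia.
by move=> k hk; apply: h; lia.
Qed.

(** Cut the positions into blocks ending where [c] holds. The blocks take descending intervals of
    values; each block is decreasing except that its largest value comes last. The predecessor makes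
    values start at 0, and [c d] keeps it from truncating at i = d. *)
Definition block_val d (c : nat -> bool) i := (d - i + (if c i then run c i else 0)).-1.

(** The tested condition says that [j] ends the block containing [i], the only way for a later entry
    to be larger. *)
Lemma block_val_ltP d (c : nat -> bool) i j : c d -> i < j <= d ->
  if (c j && [forall k : 'I_j, (i <= k) ==> ~~ c k]) then
    block_val d c i < block_val d c j
  else block_val d c j < block_val d c i.
Proof.
move=> cd ijd; rewrite /block_val.
have := run_bounds c i; have := run_bounds c j => hj hi.
case: ifP => [/andP[cj /forallP h]|].
  have h' k : i <= k < j -> ~~ c k.
    by case/andP=> ik kj; apply: (implyP (h (Ordinal kj))).
  have ci := h' i; rewrite (negbTE (ci _)); last by lia.
  by rewrite cj (run_grow _ _ _ _ h'); lia.
have [cj /negbT|cj _] := boolP (c j); last first.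
  have jd : j <> d by move=> jd; rewrite jd cd in cj.
  by case: (c i); lia.
rewrite /= negb_forall => /existsP[p]; rewrite negb_imply negbK => /andP[ip cp].
have := run_reset _ _ _ cp (ltn_ord p); have := ltn_ord p.
have [ci|ci] := boolP (c i); first by lia.
by have : (p : nat) <> i; [move=> pi; rewrite -pi cp in ci | lia].
Qed.

(** Two later entries cannot both exceed the entry at [i], since each would have to end its block.
    Strictness of the comparisons gives injectivity. *)
Lemma exists_avoider d (c : nat -> bool) : c d ->
  exists2 s : 'S_d.+1, avoiders s & forall i, (s i : nat) = block_val d c i.
Proof.
move=> cd.
have vd (i : 'I_d.+1) : block_val d c i < d.+1.
  by rewrite /block_val; have := run_bounds c i; have := ltn_ord i; case: (c i); lia.
pose f i := Ordinal (vd i).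
have f_neq (i j : 'I_d.+1) : i < j -> f i <> f j.
  move=> ij /(congr1 val) /= fij.
  have /(block_val_ltP _ _ _ _ cd) : i < j <= d by rewrite ij -ltnS ltn_ord.
  by rewrite fij ltnn if_same.
have f_inj : injective f.
  by move=> i j fij; case: (ltngtP i j) => [/f_neq|/f_neq /nesym|/val_inj].
exists (perm f_inj) => [|i]; last by rewrite permE.
apply/avoidersP=> i j k ij jk; rewrite !permE /= => -[lij lik].
have := block_val_ltP _ _ _ _ cd (_ : i < j <= d).
rewrite ij -ltnS ltn_ord => /(_ isT); case: ifP => [/andP[cj _] _|_]; last by lia.
have := block_val_ltP _ _ _ _ cd (_ : i < k <= d).
rewrite (ltn_trans ij jk) -ltnS ltn_ord => /(_ isT).
case: ifP => [/andP[_ /forallP h] _|_]; last by lia.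
by have := h (Ordinal jk); rewrite /= (ltnW ij) cj.
Qed.

Local Open Scope classical_set_scope.
Local Open Scope ring_scope.

(** * Faces of a polytope charted by the cube *)

(* On the cube s t <= max (s, 0), so the sign of [s 0 k] decides whether t_k = 1,
   t_k = 0, or t_k is free. *)
Definition cube_face {R : realType} {d} (s : 'rV[R]_d) : set 'rV[R]_d :=
  unit_cube R d `&` [set t | forall k, s 0 k * t 0 k = Num.max (s 0 k) 0].

(** Each bracket is a nonnegative defect on the cube. The weights [e] may depend on t; only their
    positivity will matter. *)
Definition slack_identity {R : realType} {d n} (e : 'rV[R]_d -> 'I_d -> R)
    (phi : 'rV[R]_d -> 'rV[R]_n) (c : 'rV[R]_n) (s : 'rV[R]_d) : Prop :=
  exists K, forall t, unit_cube R d t ->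
    dot c (phi t) = K - \sum_k e t k * (Num.max (s 0 k) 0 - s 0 k * t 0 k).

(** The weighted defects sum to 0 exactly on [cube_face s], so the functional has maximum [K],
    attained on the image of that face; a bound b > K cuts out the empty face. *)
Lemma is_face_image {R : realType} {d n} (phi : 'rV[R]_d -> 'rV[R]_n) e :
  (forall t, unit_cube R d t -> forall k, 0 < e t k) ->
  (forall c, exists s, slack_identity e phi c s) ->
  (forall s, exists c, slack_identity e phi c s) ->
  forall F, is_face (phi @` unit_cube R d) F <->
    F = set0 \/ exists s, F = phi @` cube_face s.
Proof.
move=> e_gt0 cs sc.
have def0 (s t : 'rV[R]_d) k : unit_cube R d t -> 0 <= Num.max (s 0 k) 0 - s 0 k * t 0 k :> R.
  by move=> /(_ k) /andP[t0 t1]; rewrite maxEle; case: ifP; nra.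
have faceE (s t : 'rV[R]_d) : unit_cube R d t ->
    \sum_k e t k * (Num.max (s 0 k) 0 - s 0 k * t 0 k) = 0 <-> cube_face s t.
  move=> ht; have pos k : 0 <= e t k * (Num.max (s 0 k) 0 - s 0 k * t 0 k).
    by rewrite mulr_ge0 ?def0 // ltW ?e_gt0.
  split=> [/eqP|[_ h]]; last by rewrite big1 // => k _; rewrite h subrr mulr0.
  rewrite psumr_eq0 // => /allP h; split=> // k.
  have /eqP := h k (mem_index_enum k).
  by move/eqP; rewrite mulf_eq0 gt_eqF ?e_gt0 //= subr_eq0 => /eqP ->.
have sum_ge0 (s t : 'rV[R]_d) : unit_cube R d t ->
    0 <= \sum_k e t k * (Num.max (s 0 k) 0 - s 0 k * t 0 k).
  by move=> ht; apply: sumr_ge0 => k _; rewrite mulr_ge0 ?def0 // ltW ?e_gt0.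
move=> F; split=> [[c [b [cb ->]]]|].
  have [s [K hK]] := cs c.
  (* A vertex of the cube where all defects vanish, so that [K] is attained and K <= b. *)
  pose v : 'rV[R]_d := \row_k (0 < s 0 k)%R%:R.
  have vcube : unit_cube R d v.
    by move=> k; rewrite mxE; case: (0 < _); rewrite ler01 lexx.
  have vface : cube_face s v.
    split=> // k; rewrite mxE maxElt; have [|] := ltP 0 (s 0 k).
      by move=> s0; rewrite mulr1 ltNge ltW.
    by rewrite le_eqVlt mulr0 => /orP[/eqP ->|->] //; rewrite ltxx.
  have Kb : K <= b.
    have /faceE := vface; move=> /(_ vcube) v0.
    by rewrite (le_trans _ (cb (phi v) _)) ?hK ?v0 ?subr0 //; exists v.
  have [Keb|Kneb] := eqVneq K b; last first.
    left; apply/seteqP; split=> // x [[t ht <-]] /=; rewrite hK // => hb.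
    by have := sum_ge0 s t ht; move: Kneb; rewrite -hb eq_sym; lra.
  right; exists s; apply/seteqP; split=> x.
    case=> -[t ht <-] /=; rewrite hK // -Keb => hb; exists t => //.
    by apply/faceE => //; lra.
  case=> t ft <-; have ht := ft.1; split; first by exists t.
  by rewrite /= hK // -Keb (faceE s t ht).2 // subr0.
case=> [->|[s ->]].
  exists 0, 1; split=> [x _|]; first by rewrite /dot big1 ?ler01 // => i _; rewrite mxE mul0r.
  apply/seteqP; split=> // x [_] /=; rewrite /dot big1 => [/esym/eqP|i _].
    by rewrite oner_eq0.
  by rewrite mxE mul0r.
have [c [K hK]] := sc s; exists c, K; split=> [x [t ht <-]|].
  by rewrite hK // gerBl sum_ge0.
apply/seteqP; split=> x.
  case=> t ft <-; have ht := ft.1; split; first by exists t.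
  by rewrite /= hK // (faceE s t ht).2 // subr0.
case=> -[t ht <-] /=; rewrite hK // => hb; exists t => //.
by apply/faceE => //; lra.
Qed.

Lemma is_face_cube {R : realType} {d} (F : set 'rV[R]_d) :
  is_face (unit_cube R d) F <-> F = set0 \/ exists s, F = cube_face s.
Proof.
have id_identity (s : 'rV[R]_d) : slack_identity (fun _ _ => 1) id s s.
  exists (\sum_k Num.max (s 0 k) 0) => t _; rewrite -sumrB /dot.
  by apply: eq_bigr => k _; rewrite mul1r opprB addrCA subrr addr0.
have := @is_face_image R d d id (fun _ _ => 1) (fun _ _ _ => ltr01).
move=> /(_ (fun c => ex_intro _ c (id_identity c))).
move=> /(_ (fun s => ex_intro (slack_identity _ _ ^~ s) s (id_identity s)) F).
by rewrite image_id => ->; split=> -[|[s ->]]; auto; right; exists s; rewrite ?image_id.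
Qed.

(** Nonempty faces on both sides are indexed by the same [s]. Preimage under [phi] inverts image by
    injectivity, and it reflects inclusion because faces lie in the image of the cube. *)
Lemma face_lattice_iso_cube {R : realType} {d n} (phi : 'rV[R]_d -> 'rV[R]_n) e :
  (forall t, unit_cube R d t -> forall k, 0 < e t k) ->
  (forall c, exists s, slack_identity e phi c s) ->
  (forall s, exists c, slack_identity e phi c s) ->
  set_inj (unit_cube R d) phi ->
  face_lattice_iso (phi @` unit_cube R d) (unit_cube R d).
Proof.
move=> e_gt0 cs sc phi_inj; have faceP := is_face_image phi e e_gt0 cs sc.
pose f (F : set 'rV[R]_n) := unit_cube R d `&` phi @^-1` F.
have f_face s : f (phi @` cube_face s) = cube_face s.
  apply/seteqP; split=> t; last by move=> ft; split; [exact: ft.1|exists t].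
  case=> ht [u fu ut]; rewrite -(phi_inj u t _ _ ut) ?inE //; exact: fu.1.
have f_set0 : f set0 = set0 by apply/seteqP; split=> t // -[].
have f_sub F G : is_face (phi @` unit_cube R d) F -> f F `<=` f G -> F `<=` G.
  move=> [c [b [_ ->]]] fFG x [[t ht <-] tb]; apply: (fFG t _).2.
  by split=> //; split=> //; exists t.
exists f; split; last first.
  by move=> F G hF hG; split=> [FG t [ht /FG]|/f_sub]; [split|apply].
split.
- move=> F /= /faceP[->|[s ->]]; apply/is_face_cube; first by rewrite f_set0; left.
  by rewrite f_face; right; exists s.
- move=> F G; rewrite !inE => hF hG fFG.
  by apply/seteqP; split; apply: f_sub => //; rewrite fFG.
- move=> G /= /is_face_cube[->|[s ->]].
    by exists set0 => //; apply/faceP; left.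
  by exists (phi @` cube_face s) => //; apply/faceP; right; exists s.
Qed.

(** * The Pitman-Stanley polytope *)

(* e_(k+1) = 1 + e_k - b_k, with b_k = t_k e_k. *)
Fixpoint slack {R : realType} (t : nat -> R) (k : nat) : R :=
  if k is k'.+1 then 1 + (1 - t k') * slack t k' else 1.

Definition ps_point {R : realType} d (t : nat -> R) : 'rV[R]_d.+1 :=
  \row_i ((d - i)%:R + t i * slack t i).

(** The coordinate b_i for the dilation factor [m], indexed by naturals to match [slack]. *)
Definition excess {R : realType} {d} (m : R) (x : 'rV[R]_d.+1) (i : nat) : R :=
  x 0 (inord i) - m * (d - i)%:R.

Definition ps_polytope {R : realType} d (m : R) : set 'rV[R]_d.+1 :=
  [set x | [/\ forall i, (i <= d)%N -> 0 <= excess m x i,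
     forall k, (k <= d)%N -> \sum_(i < k.+1) excess m x i <= m * k.+1%:R &
     \sum_(i < d.+1) excess m x i = m * d.+1%:R]].

Definition in01 {R : realType} (t : nat -> R) := forall i, 0 <= t i <= 1.

Section Slack.
Context {R : realType}.
Implicit Types t u : nat -> R.

Lemma slack_ge1 t k : in01 t -> 1 <= slack t k.
Proof.
move=> t01; elim: k => //= k IH; have /andP[_ t1] := t01 k.
by rewrite lerDl mulr_ge0 ?subr_ge0 // (le_trans ler01).
Qed.

Lemma slackE t k : slack t k = k.+1%:R - \sum_(i < k) t i * slack t i.
Proof.
elim: k => [|k IH]; first by rewrite big_ord0 subr0.
by rewrite big_ord_recr /= opprD addrA mulrBl mul1r {1}IH -natr1; ring.
Qed.

Lemma eq_slack t u k : (forall i, (i < k)%N -> t i = u i) -> slack t k = slack u k.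
Proof.
elim: k => //= k IH h; rewrite h // IH // => i ik.
by apply: h; apply: ltnW.
Qed.

Lemma slack_bool (c : nat -> bool) k :
  slack (fun i => (c i)%:R : R) k = (run c k)%:R.
Proof.
elim: k => //= k ->; case: (c k); rewrite ?subrr ?mul0r ?addr0 //.
by rewrite subr0 mul1r nat1r.
Qed.

Lemma excess_ps_point d t i : (i <= d)%N ->
  excess 1 (ps_point d t) i = t i * slack t i.
Proof. by move=> id; rewrite /excess mxE inordK ?mul1r ?ltnS //; ring. Qed.

(** The partial sum through k is k + 1 - (1 - t_k) e_k, with equality to k + 1 at k = d because t_d
    = 1. *)
Lemma ps_point_in d t : in01 t -> t d = 1 -> ps_polytope d 1 (ps_point d t).
Proof.
move=> t01 td.
have sumE k : (k <= d)%N ->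
    \sum_(i < k.+1) excess 1 (ps_point d t) i = k.+1%:R - (1 - t k) * slack t k.
  move=> kd; under eq_bigr => i _.
    rewrite excess_ps_point; last by have := ltn_ord i; lia.
    over.
  rewrite big_ord_recr /=.
  have -> : \sum_(i < k) t i * slack t i = k.+1%:R - slack t k.
    by rewrite (slackE t k); ring.
  by ring.
split=> [i id|k kd|].
- rewrite excess_ps_point // mulr_ge0 ?(andP (t01 i)).1 //.
  exact: le_trans ler01 (slack_ge1 _ _ t01).
- rewrite sumE // mul1r gerBl mulr_ge0 ?subr_ge0 ?(andP (t01 k)).2 //.
  exact: le_trans ler01 (slack_ge1 _ _ t01).
- by rewrite sumE // td subrr mul0r subr0 mul1r.
Qed.

(** Take t_k = b_k / e_k; the partial sum bounds give e_k >= 1. *)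
Lemma ps_polytope_param d x : ps_polytope d 1 x ->
  exists t : nat -> R, [/\ in01 t, t d = 1 & x = ps_point d t].
Proof.
move=> [x0 xle xeq].
pose e k : R := k.+1%:R - \sum_(i < k) excess 1 x i.
have e1 k : (k <= d)%N -> 1 <= e k.
  case: k => [|k] kd; rewrite /e; first by rewrite big_ord0 subr0.
  have := xle k (ltnW kd); rewrite mul1r => h.
  by rewrite -[k.+2%:R]natr1 addrAC lerDr subr_ge0.
pose t k := if (k <= d)%N then excess 1 x k / e k else 0.
have te k : (k <= d)%N -> t k * e k = excess 1 x k.
  by move=> kd; rewrite /t kd divfK // gt_eqF // (lt_le_trans ltr01 (e1 k kd)).
have slack_e k : (k <= d)%N -> slack t k = e k.
  elim: k => [_|k IH kd]; first by rewrite /e big_ord0 subr0.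
  rewrite /= IH ?(ltnW kd) // mulrBl mul1r te ?(ltnW kd) // /e big_ord_recr /=.
  rewrite -[k.+2%:R]natr1; ring.
exists t; split.
- move=> k; rewrite /t; case: leqP => [kd|_]; last by rewrite lexx ler01.
  have ek := lt_le_trans ltr01 (e1 k kd).
  rewrite divr_ge0 ?x0 ?(ltW ek) //= ler_pdivrMr // mul1r /e lerBrDr addrC.
  by have := xle k kd; rewrite big_ord_recr /= mul1r.
- rewrite /t leqnn; have ed := lt_le_trans ltr01 (e1 d (leqnn d)).
  apply: (canLR (mulfK _)); first by rewrite gt_eqF.
  by move: xeq; rewrite big_ord_recr /= !mul1r /e => <-; ring.
- apply/rowP=> i; have id : (i <= d)%N by rewrite -ltnS.
  rewrite mxE slack_e // te // /excess mul1r inord_val; ring.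
Qed.

Definition upd t k (v : R) i := if i == k then v else t i.

(** The recursion uses t_k only once, in passing from e_k to e_(k+1), so each slack is affine in
    t_k. *)
Lemma slack_upd t k i :
  slack t i = t k * slack (upd t k 1) i + (1 - t k) * slack (upd t k 0) i.
Proof.
elim: i => [|i IH] /=; first by ring.
have [->|ik] := eqVneq i k.
  have u v : slack (upd t k v) k = slack t k.
    by apply: eq_slack => j jk; rewrite /upd ltn_eqF.
  by rewrite !u /upd eqxx; ring.
have u v : upd t k v i = t i by rewrite /upd (negbTE ik).
by rewrite !u IH; ring.
Qed.

(** At coordinate [k] the product t_k e_k stays affine in t_k, as e_k involves earlier parameters
    only. *)
Lemma ps_point_upd d t k :
  ps_point d t =
  t k *: ps_point d (upd t k 1) + (1 - t k) *: ps_point d (upd t k 0).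
Proof.
apply/rowP=> i; rewrite !mxE {1}(slack_upd t k).
have [->|ik] := eqVneq (i : nat) k.
  have u v : slack (upd t k v) k = slack t k.
    by apply: eq_slack => j jk; rewrite /upd ltn_eqF.
  by rewrite !u /upd eqxx; ring.
have u v : upd t k v i = t i by rewrite /upd (negbTE ik).
by rewrite !u; ring.
Qed.

(** Replace the parameters by 0 or 1 one at a time; in [main], only those below [k] may still be
    fractional. *)
Lemma ps_point_convex d (C : set 'rV[R]_d.+1) t :
  (forall x y (p : R), 0 <= p <= 1 -> C x -> C y -> C (p *: x + (1 - p) *: y)) ->
  (forall c : nat -> bool, c d -> C (ps_point d (fun i => (c i)%:R))) ->
  in01 t -> t d = 1 -> C (ps_point d t).
Proof.
move=> Ccvx Cvert.
suff main k : (k <= d)%N -> forall t, in01 t -> t d = 1 ->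
    (forall i, (k <= i)%N -> t i = 0 \/ t i = 1) -> C (ps_point d t).
  move=> t01 td.
  (* Parameters beyond [d] do not affect the point; setting them to 0 meets the hypothesis of
     [main]. *)
  have -> : ps_point d t = ps_point d (fun i => if (i <= d)%N then t i else 0).
    apply/rowP=> i; have id : (i <= d)%N by rewrite -ltnS.
    rewrite !mxE id; congr (_ + _ * _); apply: eq_slack => j ji.
    by rewrite (ltnW (leq_trans ji id)).
  apply: (main d (leqnn d)) => [i||i di] /=.
  - by case: leqP => // _; rewrite lexx ler01.
  - by rewrite leqnn.
  - by case: leqP => [id|_]; [right; rewrite (_ : i = d) //; lia|left].
elim: k => [_|k IH kd] {}t t01 td tk.
  have -> : t = fun i => (t i == 1)%:R.
    by apply/funext=> i; have [->|->] := tk i isT; rewrite ?eqxx // eq_sym oner_eq0.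
  by apply: Cvert; apply/eqP.
have updP v : v = 0 \/ v = 1 -> C (ps_point d (upd t k v)).
  move=> hv; apply: IH; first exact: ltnW.
  - move=> i; rewrite /upd; case: eqP => // _.
    by case: hv => ->; rewrite ?lexx ?ler01.
  - by rewrite /upd gtn_eqF.
  - by move=> i; rewrite /upd leq_eqVlt eq_sym => /orP[->//|ki]; rewrite gtn_eqF //; apply: tk.
by rewrite (ps_point_upd d t k); apply: Ccvx => //; apply: updP; [right|left].
Qed.

Lemma ps_polytope_convex d x y (p : R) : 0 <= p <= 1 ->
  ps_polytope d 1 x -> ps_polytope d 1 y ->
  ps_polytope d 1 (p *: x + (1 - p) *: y).
Proof.
move=> /andP[p0 p1] [x1 x2 x3] [y1 y2 y3].
have ex i : excess 1 (p *: x + (1 - p) *: y) i =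
    p * excess 1 x i + (1 - p) * excess 1 y i.
  by rewrite /excess !mxE; ring.
have exs k : \sum_(i < k) excess 1 (p *: x + (1 - p) *: y) i =
    p * \sum_(i < k) excess 1 x i + (1 - p) * \sum_(i < k) excess 1 y i.
  by rewrite !mulr_sumr -big_split; apply: eq_bigr => i _; exact: ex.
split=> [i id|k kd|].
- by rewrite ex addr_ge0 // mulr_ge0 ?x1 ?y1 ?subr_ge0.
- by rewrite exs; have := x2 k kd; have := y2 k kd; nra.
- by rewrite exs x3 y3; ring.
Qed.

Lemma convex_setP {d} (C : set 'rV[R]_d) : convex_set C <->
  forall x y (p : R), 0 <= p <= 1 -> C x -> C y -> C (p *: x + (1 - p) *: y).
Proof.
split=> [hC x y p /andP[p0 p1] Cx Cy|hC x y p].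
  have := hC x y (Itv01 p0 p1); rewrite !inE; exact.
rewrite !inE => Cx Cy; apply: hC => //; apply/andP; split.
  exact: ge0.
exact: le1.
Qed.

End Slack.

(** * The avoidance polytope as a Pitman-Stanley polytope, its dilates and its cube chart *)

Section Hull.
Context {R : realType}.

(** As a_i = s(i) + 1, the first k excesses sum to k plus the sum of s(i) - (d - i), which the
    prefix bound makes nonpositive. *)
Lemma perm_point_in d (s : 'S_d.+1) : avoiders s ->
  ps_polytope d 1 (perm_point R s).
Proof.
move=> hs.
have exE i : excess 1 (perm_point R s) i = (s (inord i)).+1%:R - (d - i)%:R.
  by rewrite /excess mxE mul1r.
have sumE k : \sum_(i < k) excess 1 (perm_point R s) i =
    (\sum_(i < k) s (inord i))%N%:R - (\sum_(i < k) (d - i))%N%:R + k%:R.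
  under eq_bigr do rewrite exE -natr1 addrAC.
  by rewrite big_split /= sumr_const card_ord !natr_sum -sumrB.
split=> [i id|k kd|].
- rewrite exE subr_ge0 ler_nat; have := avoider_lower_bound d s (inord i) hs.
  by rewrite inordK.
- by rewrite sumE mul1r gerDr subr_le0 ler_nat sum_perm_inord_le.
- by rewrite sumE sum_perm_inord subrr add0r mul1r.
Qed.

Lemma ps_point_bool d (c : nat -> bool) : c d ->
  exists2 s : 'S_d.+1, avoiders s &
    ps_point d (fun i => (c i)%:R) = perm_point R s.
Proof.
move=> cd; have [s hs sE] := exists_avoider d c cd.
exists s => //; apply/rowP=> i; rewrite !mxE sE slack_bool -natrM -natrD.
congr _%:R; rewrite /block_val; have := ltn_ord i; have := run_bounds c i.
have [-> |/eqP id] := eqVneq (i : nat) d; first by rewrite cd; lia.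
by case: (c i); lia.
Qed.

Lemma avoidance_polytopeE d :
  avoidance_polytope R d.+1 [:: [:: 1; 2; 3]%N; [:: 1; 3; 2]%N] =
  ps_polytope d 1.
Proof.
apply/seteqP; split.
  apply: smallest_sub; last by move=> _ [s hs <-]; exact: perm_point_in.
  by apply/convex_setP => x y p; exact: ps_polytope_convex.
move=> x /ps_polytope_param[t [t01 td ->]] C [/convex_setP Ccvx Cvert].
apply: ps_point_convex => // c cd; apply: Cvert.
by have [s hs ->] := ps_point_bool d c cd; exists s.
Qed.

Lemma dilate_ps_polytope d m :
  dilate m (ps_polytope d 1) = ps_polytope d m%:R :> set 'rV[R]_d.+1.
Proof.
have exZ (x : 'rV[R]_d.+1) i : excess m%:R (m%:R *: x) i = m%:R * excess 1 x i.
  by rewrite /excess mxE; ring.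
have sumZ (x : 'rV[R]_d.+1) k :
    \sum_(i < k) excess m%:R (m%:R *: x) i = m%:R * \sum_(i < k) excess 1 x i.
  by rewrite mulr_sumr; apply: eq_bigr => i _; exact: exZ.
apply/seteqP; split=> [_ [x [x0 xle xeq] <-]|x].
  split=> [i id|k kd|]; first by rewrite exZ mulr_ge0 ?x0.
    by rewrite sumZ ler_wpM2l //; have := xle k kd; rewrite mul1r.
  by rewrite sumZ xeq mul1r.
(* For m = 0 one cannot divide by [m]: nonnegative excesses of sum 0 force x = 0, which is 0 times
   any point of the polytope, such as the one with all t_i = 1. *)
case: (posnP m) => [->|m_gt0].
  move=> [x0 _ xeq].
  have [y hy] : exists y : 'rV[R]_d.+1, ps_polytope d 1 y.
    by exists (ps_point d (fun=> 1)); apply: ps_point_in => // i; rewrite ler01 lexx.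
  exists y => //; rewrite scale0r; apply/rowP=> i; rewrite mxE.
  have id : (i <= d)%N by rewrite -ltnS.
  move: xeq; rewrite mul0r => /eqP; rewrite psumr_eq0.
    move=> /allP /(_ i (mem_index_enum i)) /eqP.
    by rewrite /excess inord_val mul0r subr0.
  by move=> j _; apply: x0; rewrite -ltnS.
have mgt : 0 < m%:R :> R by rewrite ltr0n.
have mU : m%:R != 0 :> R by rewrite gt_eqF.
have [y ->] : exists y : 'rV[R]_d.+1, x = m%:R *: y.
  by exists (m%:R^-1 *: x); rewrite scalerA divff // scale1r.
move=> [x0 xle xeq]; exists y => //; split=> [i id|k kd|].
- by have := x0 i id; rewrite exZ pmulr_rge0.
- by have := xle k kd; rewrite sumZ ler_pM2l // mul1r.
- by move: xeq; rewrite sumZ mul1r => /(mulfI mU).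
Qed.

(* The coordinate t_d is forced to be 1; the junk values beyond it are also 1. *)
Definition cube_coord {d} (t : 'rV[R]_d) (i : nat) : R :=
  oapp (t 0) 1 (insub i).

Lemma cube_coord_ord {d} (t : 'rV[R]_d) (i : 'I_d) : cube_coord t i = t 0 i.
Proof. by rewrite /cube_coord valK. Qed.

Lemma cube_coord_last {d} (t : 'rV[R]_d) : cube_coord t d = 1.
Proof. by rewrite /cube_coord insubF ?ltnn. Qed.

Lemma cube_coord01 {d} (t : 'rV[R]_d) : unit_cube R d t -> in01 (cube_coord t).
Proof.
move=> ht i; rewrite /cube_coord; case: insubP => [k _ _|_] /=; first exact: ht.
by rewrite ler01 lexx.
Qed.

Definition ps_chart d (t : 'rV[R]_d) : 'rV[R]_d.+1 := ps_point d (cube_coord t).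

Lemma ps_chart_image d : ps_chart d @` unit_cube R d = ps_polytope d 1.
Proof.
apply/seteqP; split=> [_ [t ht <-]|x /ps_polytope_param[t [t01 td ->]]].
  by apply: ps_point_in; [exact: cube_coord01|exact: cube_coord_last].
exists (\row_i t i) => [i|]; first by rewrite mxE t01.
have tE i : (i <= d)%N -> cube_coord (\row_(i < d) t i) i = t i.
  rewrite leq_eqVlt => /orP[/eqP ->|id]; first by rewrite cube_coord_last td.
  by rewrite -[i]/(val (Ordinal id)) cube_coord_ord mxE.
apply/rowP=> i; have id : (i <= d)%N by rewrite -ltnS.
rewrite !mxE tE //; congr (_ + _ * _); apply: eq_slack => j ji.
by rewrite tE // (leq_trans (ltnW ji)).
Qed.

(** The b_i determine the slacks, and these are positive, so t_i = b_i / e_i is recovered. *)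
Lemma ps_chart_inj d : set_inj (unit_cube R d) (ps_chart d).
Proof.
move=> t u; rewrite !inE => ht hu tu.
have bE i : (i <= d)%N -> cube_coord t i * slack (cube_coord t) i =
    cube_coord u i * slack (cube_coord u) i.
  by move=> id; rewrite -!(excess_ps_point d) // -/(ps_chart d t) tu.
apply/rowP=> i; rewrite -!cube_coord_ord; have id : (i <= d)%N by apply: ltnW.
have slackE' : slack (cube_coord t) i = slack (cube_coord u) i.
  rewrite !slackE; congr (_ - _); apply: eq_bigr => j _; apply: bE.
  by rewrite (leq_trans (ltnW (ltn_ord j))).
have := bE i id; rewrite slackE'; apply: mulIf; rewrite gt_eqF //.
exact: lt_le_trans ltr01 (slack_ge1 _ _ (cube_coord01 _ hu)).
Qed.

(* Used with [beta k] the coefficient of e_k in the maximum over t_k, ..., t_(d-1) of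
   the left-hand side restricted to indices at least [k]. *)
Lemma telescoped_dot (c beta t : nat -> R) d :
  \sum_(k < d) c k * (t k * slack t k) + beta d * slack t d =
  \sum_(k < d) beta k.+1 + beta 0
  - \sum_(k < d) slack t k * (beta k - beta k.+1 - (c k - beta k.+1) * t k).
Proof.
elim: d => [|d IH]; first by rewrite !big_ord0 /=; ring.
rewrite !big_ord_recr /=.
have -> : \sum_(k < d) c k * (t k * slack t k) =
   \sum_(k < d) beta k.+1 + beta 0
   - \sum_(k < d) slack t k * (beta k - beta k.+1 - (c k - beta k.+1) * t k)
   - beta d * slack t d by rewrite -IH addrK.
ring.
Qed.

(** The offsets d - i only contribute to [K]. Since t_d = 1, the last coordinate supplies the
    [beta d] term of [telescoped_dot], whose brackets become the defects. *)
Lemma ps_chart_identity d (c : 'rV[R]_d.+1) (beta : nat -> R) (s : 'rV[R]_d) :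
  beta d = c 0 ord_max ->
  (forall k : 'I_d, s 0 k = c 0 (widen_ord (leqnSn d) k) - beta k.+1) ->
  (forall k : 'I_d, beta k - beta k.+1 = Num.max (s 0 k) 0) ->
  slack_identity (fun t k => slack (cube_coord t) k) (ps_chart d) c s.
Proof.
move=> bd sE bE.
exists (\sum_(i < d.+1) c 0 i * (d - i)%:R + (\sum_(k < d) beta k.+1 + beta 0)).
move=> t ht; rewrite -addrA.
have /= := telescoped_dot (fun i => c 0 (inord i)) beta (cube_coord t) d.
under [X in _ = _ - X]eq_bigr => k _.
  have -> : (inord k : 'I_d.+1) = widen_ord (leqnSn d) k.
    by apply/val_inj; rewrite /= inordK // ltnS ltnW.
  rewrite -sE bE cube_coord_ord; over.
move=> <-; rewrite bd /dot big_ord_recr [in RHS]big_ord_recr /=.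
rewrite !mxE /= cube_coord_last mul1r subnn mulr0 addr0 add0r addrA -big_split /=.
congr (_ + _); apply: eq_bigr => k _; rewrite mxE /= mulrDr; congr (_ + _ * _).
by congr (c 0 _); apply/val_inj; rewrite /= inordK // ltnS ltnW.
Qed.

Lemma exists_backward_max (c : nat -> R) d : exists beta : nat -> R,
  beta d = c d /\ forall k, (k < d)%N -> beta k = Num.max (c k) (beta k.+1).
Proof.
elim: d c => [|d IH] c; first by exists c.
have [b [bd bk]] := IH (fun k => c k.+1).
exists (fun k => if k is k'.+1 then b k' else Num.max (c 0%N) (b 0%N)).
by split=> // -[|k] //; exact: bk.
Qed.

Lemma ps_polytope_iso d :
  face_lattice_iso (ps_polytope d 1 : set 'rV[R]_d.+1) (unit_cube R d).
Proof.
rewrite -ps_chart_image.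
apply: (face_lattice_iso_cube _ (fun t k => slack (cube_coord t) k)).
- move=> t ht k; exact: lt_le_trans ltr01 (slack_ge1 _ _ (cube_coord01 _ ht)).
- move=> c; have [b [bd bk]] := exists_backward_max (fun i => c 0 (inord i)) d.
  (* Per unit of t_k e_k the functional gains c_k and gives up [b k.+1], the best coefficient
     available later. *)
  exists (\row_k (c 0 (widen_ord (leqnSn d) k) - b k.+1)).
  apply: (ps_chart_identity _ _ b) => [|k|k]; rewrite ?mxE //.
    by rewrite bd; congr (c 0 _); apply/val_inj; rewrite /= inordK.
  rewrite bk // (_ : inord k = widen_ord (leqnSn d) k); last first.
    by apply/val_inj; rewrite /= inordK // ltnS ltnW.
  by rewrite -[X in _ = Num.max _ X](subrr (b k.+1)) -addr_maxl.
- move=> s.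
  (* Conversely the increments of [b] must be max(s_k, 0); starting from b_d = 0 gives c_d = 0 and
     c_k = s_k + b_(k+1). *)
  pose b k := \sum_(i < d | (k <= i)%N) Num.max (s 0 i) 0.
  exists (\row_(i < d.+1)
    if insub (i : nat) is Some k then s 0 k + b k.+1 else 0).
  apply: (ps_chart_identity _ _ b) => [|k|k].
  + rewrite mxE insubF /= ?ltnn // /b big_pred0 // => i.
    by rewrite leqNgt ltn_ord.
  + by rewrite mxE /= valK addrK.
  + rewrite /b (bigD1 k) //= -addrA (eq_bigl (fun i : 'I_d => k < i)%N).
      by rewrite subrr addr0.
    by move=> i; rewrite ltn_neqAle andbC eq_sym.
- exact: ps_chart_inj.
Qed.

End Hull.

(** * Lattice points *)

Lemma card_image_seq {T : eqType} {U : Type} (f : T -> U) (s : seq T) :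
  uniq s -> {in s &, injective f} ->
  ([set f x | x in [set` s]] #= `I_(size s))%card.
Proof.
(* The empty list is treated apart because [nth] needs a default element. *)
case: s => [_ _|x0 s us f_inj].
  have -> : [set f x | x in [set` [::]]] = set0.
    by apply/seteqP; split=> // y [x].
  by rewrite /= II0.
move: (x0 :: s) us f_inj => {}s us f_inj.
have -> : [set f x | x in [set` s]] = (fun i => f (nth x0 s i)) @` `I_(size s).
  apply/seteqP; split=> [_ [x /= xl <-]|_ [i /= il <-]].
    by exists (index x s); rewrite /= ?index_mem ?nth_index.
  by exists (nth x0 s i) => //=; rewrite mem_nth.
apply: inj_card_eq => i j; rewrite !inE /= => il jl /f_inj.
by rewrite !mem_nth // => /(_ isT isT) /eqP; rewrite nth_uniq // => /eqP.
Qed.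

Lemma sumn_take (s : seq nat) k : sumn (take k s) = (\sum_(i < k) nth 0 s i)%N.
Proof.
elim: s k => [|a s IH] k.
  by rewrite big1 // => i _; rewrite nth_nil.
by case: k => [|k]; rewrite /= ?big_ord0 // big_ord_recl /= IH.
Qed.

Section Ehrhart.
Context {R : realType}.

(** [u] lists the first [d] excesses; the prescribed total m (d + 1) forces the last coordinate. *)
Definition lattice_point m d (u : seq nat) : 'rV[R]_d.+1 :=
  \row_(i < d.+1) (if (i < d)%N then m%:R * (d - i)%:R + (nth 0%N u i)%:R
                   else m%:R * d.+1%:R - (sumn u)%:R).

Lemma excess_lattice_point m d u i : (i < d)%N ->
  excess m%:R (lattice_point m d u) i = (nth 0%N u i)%:R.
Proof.
move=> id; rewrite /excess mxE inordK; last by rewrite ltnS ltnW.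
by rewrite id addrAC subrr add0r.
Qed.

Lemma sum_excess_lattice_point m d u k : (k <= d)%N ->
  \sum_(i < k) excess m%:R (lattice_point m d u) i = (sumn (take k u))%:R.
Proof.
move=> kd; rewrite sumn_take natr_sum; apply: eq_bigr => i _.
by rewrite excess_lattice_point // (leq_trans (ltn_ord i)).
Qed.

Lemma excess_lattice_point_last m d u :
  excess m%:R (lattice_point m d u) d = m%:R * d.+1%:R - (sumn u)%:R.
Proof. by rewrite /excess mxE inordK // ltnn subnn mulr0 subr0. Qed.

(** Integrality and nonnegativity make the excesses natural. The bound m (i + 1) = m + m i explains
    the initial bound [m] in [ps_seqs]. Conversely the last excess is nonnegative, as the others
    total at most m d. *)
Lemma lattice_points_ps_polytope m d : (0 < d)%N ->
  ps_polytope d m%:R `&` lattice_points R d.+1 =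
  lattice_point m d @` [set` ps_seqs m d m].
Proof.
move=> d_gt0; apply/seteqP; split=> [x [[x0 xle xeq] xint]|_ [u /mem_ps_seqs[su hu] <-]].
  pose u := mkseq (fun i => Num.truncn (excess m%:R x i)) d.
  have exN i : (i <= d)%N -> excess m%:R x i \is a Num.nat.
    move=> id; rewrite natrEint x0 // andbT /excess rpredB ?xint //.
    by rewrite rpredM ?rpred_nat.
  have uE i : (i < d)%N -> (nth 0%N u i)%:R = excess m%:R x i.
    by move=> id; rewrite nth_mkseq // truncnK // exN // ltnW.
  have usum k : (k <= d)%N -> (sumn (take k u))%:R = \sum_(i < k) excess m%:R x i.
    move=> kd; rewrite sumn_take natr_sum; apply: eq_bigr => i _.
    by rewrite uE // (leq_trans (ltn_ord i)).
  have su : size u = d by rewrite size_mkseq.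
  exists u.
    apply/mem_ps_seqs; split=> // i id; rewrite -mulnS -(ler_nat R) natrM usum //.
    exact/xle/ltnW.
  apply/rowP=> i; rewrite mxE.
  have -> : x 0 i = excess m%:R x i + m%:R * (d - i)%:R.
    by rewrite /excess inord_val subrK.
  have [id|di] := ltnP i d; first by rewrite uE // addrC.
  have -> : (i : nat) = d by apply/eqP; rewrite eqn_leq di -ltnS ltn_ord.
  rewrite -[in sumn u](take_size u) su usum // subnn mulr0 addr0.
  by rewrite -xeq big_ord_recr /= addrAC subrr add0r.
have sumu : sumn u = sumn (take d u) by rewrite -su take_size.
have udm : (sumn u <= m * d)%N.
  (* The constraint of largest index, d - 1, bounds the whole sum. *)
  by rewrite sumu; have := hu d.-1; rewrite prednK // -mulnS prednK //; exact.
have last_le : (sumn u)%:R <= m%:R * d.+1%:R :> R.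
  by rewrite -natrM ler_nat (leq_trans udm) // leq_mul2l leqnSn orbT.
have total : \sum_(i < d.+1) excess m%:R (lattice_point m d u) i = m%:R * d.+1%:R.
  by rewrite big_ord_recr /= sum_excess_lattice_point // -sumu
    excess_lattice_point_last addrC subrK.
split; first split=> // [i|k].
- rewrite leq_eqVlt => /orP[/eqP ->|id].
    by rewrite excess_lattice_point_last subr_ge0.
  by rewrite excess_lattice_point.
- rewrite leq_eqVlt => /orP[/eqP ->|kd]; first by rewrite total.
  by rewrite sum_excess_lattice_point // -natrM ler_nat mulnS hu.
- move=> i; rewrite mxE; case: ifP => _; rewrite ?rpredB ?rpredD ?rpredM ?rpred_nat //.
Qed.

Lemma lattice_point_inj m d :
  {in ps_seqs m d m &, injective (lattice_point m d)}.
Proof.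
move=> u v /mem_ps_seqs[su _] /mem_ps_seqs[sv _] uv.
apply: (@eq_from_nth _ 0%N) => [|i]; rewrite su ?sv // => id.
by apply/eqP; rewrite -(eqr_nat R) -!(excess_lattice_point m d) // uv.
Qed.

Lemma ps_polytope_ehrhart d : (0 < d)%N ->
  is_ehrhart_polynomial (ps_polytope d 1 : set 'rV[R]_d.+1)
    (d`!%:R^-1 *:
      (('X + 1) * \prod_(2 <= j < d.+1) (d.+1%:R *: 'X + j%:R%:P))).
Proof.
move=> d_gt0 m; exists (size (ps_seqs m d m)); split.
  rewrite dilate_ps_polytope lattice_points_ps_polytope //.
  by apply: card_image_seq; [exact: uniq_ps_seqs|exact: lattice_point_inj].
have fact_neq0 : d`!%:R != 0 :> rat by rewrite pnatr_eq0 -lt0n fact_gt0.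
rewrite hornerZ hornerM hornerD hornerX hornerC horner_prod.
apply: (mulfI fact_neq0); rewrite mulVKf // mulrC -natrM.
(* Now n = d + 2 and e = m, so the factor e + (d + 1) m + j is n m + j. *)
case: d d_gt0 fact_neq0 => // d _ _; rewrite size_ps_seqs natrM natr_prod natr1.
congr (_ * _); apply: eq_bigr => j _.
by rewrite hornerD hornerZ hornerX hornerC -natrM -natrD -mulSn.
Qed.

End Ehrhart.

Lemma ps_polytope_is_polytope {R : realType} d :
  is_polytope (ps_polytope d 1 : set 'rV[R]_d.+1).
Proof.
exists (@perm_point R d.+1 @` avoiders); split; last by rewrite -avoidance_polytopeE.
exact/finite_image/finite_finset.
Qed.

Theorem theorem3p16 (R : realType) (n : nat) (hn : (0 < n)%N) :
  let P := avoidance_polytope R n [:: [:: 1; 2; 3]%N; [:: 1; 3; 2]%N] in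
  combinatorial_cube P /\
  ((1 < n)%N ->
   is_ehrhart_polynomial P
     ((n.-1)`!%:R^-1 *:
        (('X + 1) * \prod_(2 <= j < n) (n%:R *: 'X + j%:R%:P)))).
Proof.
case: n hn => // d _ P; rewrite /P avoidance_polytopeE.
split; last exact: ps_polytope_ehrhart.
by split; [exact: ps_polytope_is_polytope|exists d; exact: ps_polytope_iso].
Qed.
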